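(* For every positive integer $n$, $\lceil n/2\rceil \leq b_2(K_n)\leq \lceil n/2\rceil+1$. Moreover, for every positive integer $k$, $b_2(K_{8k-1})=b_2(K_{8k})=4k$ and $b_2(K_{8k+1})=4k+1$.
   Context: $K_n$ is the complete graph on $n$ vertices. For a finite simple graph $G=(V,E)$, a biclique on a subset of $V$ is given by two disjoint sets $X,Y\subseteq V$; its edges are all pairs $\{x,y\}$ with $x\in X$, $y\in Y$. An odd cover of $G$ is a collection of bicliques on subsets of $V$ such that every pair of vertices adjacent in $G$ is an edge of an odd number of the bicliques, and every pair of distinct non-adjacent vertices is an edge of an even number of the bicliques. $b_2(G)$ denotes the minimum cardinality of an odd cover of $G$.
   Formalization: An odd cover is required to be a nonempty collection of bicliques; otherwise the empty collection would be an odd cover of K_1, so b_2(K_1)=0 and the lower bound would fail at n=1. For n ≥ 2 this changes nothing. *)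

(* Defs.v *)
From HB Require Import structures.
From mathcomp Require Import all_boot.

Set Implicit Arguments.
Unset Strict Implicit.
Unset Printing Implicit Defensive.

Record sgraph := SGraph {
  vertex :> finType;
  adj : rel vertex;
  adj_sym : symmetric adj;
  adj_irrefl : irreflexive adj }.

Section CompleteGraph.
Variable n : nat.

Definition complete_adj : rel 'I_n := fun i j => i != j.

Lemma complete_adj_sym : symmetric complete_adj.
Proof. by move=> i j; rewrite /complete_adj eq_sym. Qed.

Lemma complete_adj_irrefl : irreflexive complete_adj.
Proof. by move=> i; rewrite /complete_adj eqxx. Qed.

Definition complete_graph : sgraph := SGraph complete_adj_sym complete_adj_irrefl.

End CompleteGraph.

(* The two parts are disjoint, possibly empty, sets of vertices. *)
Definition biclique (V : finType) :=
  {XY : {set V} * {set V} | [disjoint XY.1 & XY.2]}.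

Section OddCover.
Variable G : sgraph.

Definition covers (x y : G) (B : biclique G) : bool :=
  ((x \in (val B).1) && (y \in (val B).2)) ||
  ((y \in (val B).1) && (x \in (val B).2)).

Definition parity_cover (s : seq (biclique G)) : bool :=
  [forall x : G, forall y : G,
     (x != y) ==> (odd (count (covers x y) s) == adj x y)].

(* A collection of bicliques is a finite family, given as a sequence; it is
   required to be nonempty.  By parity_cover_neq0 below, the latter condition
   only matters for graphs without edges, where it makes the minimum 1 (attained
   by a biclique with an empty part) instead of 0.  Some such convention is
   needed for the lower bound ceil(n/2) <= b2(K_n) to hold at n = 1. *)
Definition odd_cover (s : seq (biclique G)) : bool :=
  (0 < size s) && parity_cover s.

Lemma parity_cover_neq0 (x y : G) (s : seq (biclique G)) :
  adj x y -> parity_cover s -> 0 < size s.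
Proof.
case: s => // xy /forallP/(_ x)/forallP/(_ y)/implyP H.
have xNy : x != y by apply: contraTneq xy => ->; rewrite adj_irrefl.
by have := H xNy; rewrite xy.
Qed.

Lemma odd_cover_exists :
  exists m, [exists s : m.-tuple (biclique G), odd_cover s].
Proof.
have d0 : [disjoint (set0 : {set G}, set0 : {set G}).1 &
           (set0 : {set G}, set0 : {set G}).2] by rewrite -setI_eq0 setI0.
pose B0 : biclique G := exist _ (set0, set0) d0.
pose f (p : G * G) : biclique G := insubd B0 ([set p.1], [set p.2]).
pose P := [pred p : G * G | adj p.1 p.2 && (enum_rank p.1 < enum_rank p.2)].
pose s := B0 :: [seq f p | p <- enum P].
exists (size s); apply/existsP; exists (in_tuple s); rewrite /odd_cover /=.
have cB0 x y : covers x y B0 = false by rewrite /covers /= !inE.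
apply/forallP => x; apply/forallP => y; apply/implyP => xNy.
rewrite /= cB0 add0n count_map -size_filter.
have Hf p : p \in P -> val (f p) = ([set p.1], [set p.2]).
  rewrite inE => /andP[ap _]; rewrite /f val_insubd /= disjoints1 inE.
  by case: eqP => // E; rewrite E adj_irrefl in ap.
have Hc p : p \in P -> covers x y (f p) = (p == (x, y)) || (p == (y, x)).
  move=> pP; rewrite /covers Hf //= !inE; case: p {pP} => a b /=.
  by rewrite !xpair_eqE (eq_sym x) (eq_sym y) (eq_sym x) (eq_sym y).
wlog lt_xy : x y xNy Hc / enum_rank x < enum_rank y.
  move=> W; case: (ltngtP (enum_rank x) (enum_rank y)) => [|lt|/val_inj E].
  - exact: W.
  - have C : covers x y =1 covers y x by move=> p; rewrite /covers orbC.
    rewrite adj_sym (eq_filter (a2 := covers y x \o f)) => [|p]; last exact: C.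
    apply: W; rewrite 1?eq_sym // => p /Hc.
    by rewrite C orbC.
  - by rewrite (enum_rank_inj E) eqxx in xNy.
have -> : [seq p <- enum P | (covers x y \o f) p] =
          [seq p <- enum P | p == (x, y)].
  apply: eq_in_filter => p; rewrite mem_enum => pP /=; rewrite Hc //.
  case: (p =P (y, x)) => [E|_]; last by rewrite orbF.
  by move: pP; rewrite E inE /= => /andP[_ /ltn_trans/(_ lt_xy)]; rewrite ltnn.
rewrite size_filter count_uniq_mem ?enum_uniq // mem_enum inE /= lt_xy andbT.
by case: (adj x y).
Qed.

Definition b2 : nat := ex_minn odd_cover_exists.

End OddCover.

(* Main.v *)
(** Label each vertex with a word over {0, 1, *}, the letter in column [l]
    telling on which side of the [l]-th biclique it lies, if any.  The bicliques
    cover K_n oddly iff any two words conflict (0 against 1) in an odd number of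
    columns.

    Upper bounds: given signs [s i l], the words [s i l + e] with a joker at
    [l = i] form [2t] words of length [t], whose conflicts depend only on the row
    sums of [s] and on [s i j + s j i].  The transitive tournament
    [s i l = (i < l)] works after adding one column, and for [4 | t] no extra
    column is needed once the pairs of odd indices are flipped.

    Lower bound: over F_2, m bicliques give J - I = N^T U with
    N = (X; Y), U = (Y; X) having 2m rows.  If n is even, J - I is its own
    inverse, so n <= 2m.  If n is odd, J - I is idempotent of rank at least n - 1;
    if 2m = n - 1, cancelling N^T and U in (N^T U)^2 = N^T U gives
    U N^T = I, hence Y X^T = I, while its diagonal vanishes because the parts of
    a biclique are disjoint. *)

Require Import Defs.
From mathcomp Require Import all_boot all_algebra.

Set Implicit Arguments.
Unset Strict Implicit.
Unset Printing Implicit Defensive.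

Import GRing.Theory.

(** * Codes over {0, 1, *} and the odd covers they define *)

Definition conflict (u v : option bool) : bool :=
  if u is Some a then if v is Some b then a (+) b else false else false.

Definition odd_code (T L : finType) (f : T -> L -> option bool) : Prop :=
  forall x y, x != y -> \big[addb/false]_l conflict (f x l) (f y l) = true.

Lemma odd_count (I : Type) (a : pred I) (s : seq I) :
  odd (count a s) = \big[addb/false]_(i <- s) a i.
Proof.
by elim: s => [|i s IH]; rewrite ?big_nil ?big_cons //= oddD IH oddb.
Qed.

Lemma b2_le (G : sgraph) (s : seq (biclique G)) :
  odd_cover s -> b2 G <= size s.
Proof.
rewrite /b2; case: ex_minnP => m _ min_m s_cover; apply: min_m.
by apply/existsP; exists (in_tuple s).
Qed.

Section CodeCover.
Variables (V L : finType) (f : V -> L -> option bool).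

Definition code_parts (l : L) : {set V} * {set V} :=
  ([set x | f x l == Some true], [set x | f x l == Some false]).

Lemma code_parts_disjoint l : [disjoint (code_parts l).1 & (code_parts l).2].
Proof.
rewrite -setI_eq0; apply/eqP/setP => x; rewrite !inE /=.
by case: (f x l) => [[]|].
Qed.

Definition code_biclique (l : L) : biclique V :=
  exist (fun XY : {set V} * {set V} => is_true [disjoint XY.1 & XY.2]) _
    (code_parts_disjoint l).

End CodeCover.

Lemma b2_complete_le (n : nat) (T L : finType) (f : T -> L -> option bool) :
  n <= #|T| -> 0 < #|L| -> odd_code f -> b2 (complete_graph n) <= #|L|.
Proof.
move=> n_le L_gt0 f_odd.
pose g (i : complete_graph n) := f (enum_val (widen_ord n_le i)).
rewrite cardE -(size_map (code_biclique g)); apply: b2_le.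
rewrite /odd_cover size_map -cardE L_gt0.
apply/forallP => x; apply/forallP => y; apply/implyP => xNy.
rewrite [adj _ _]xNy eqb_id count_map odd_count big_enum /=.
have eNy : enum_val (widen_ord n_le x) != enum_val (widen_ord n_le y).
  by rewrite (inj_eq enum_val_inj) -(inj_eq val_inj).
apply: etrans (f_odd _ _ eNy); apply: eq_bigr => l _.
rewrite /covers /= !inE /g.
by case: (f _ l) => [[]|]; case: (f _ l) => [[]|].
Qed.

(** The extra column sets the new word, all jokers elsewhere, against every old word; old words
    agree there, so their conflicts are unchanged. *)
Lemma odd_code_star (T L : finType) (f : T -> L -> option bool) :
  odd_code f ->
  odd_code (fun (x : option T) (l : L + unit) =>
    match x, l with
    | Some x, inl l => f x l
    | None, inl _ => None
    | _, inr _ => Some (x == None)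
    end).
Proof.
move=> f_odd x y xNy.
have bigN (F : L -> bool) : F =1 xpred0 -> \big[addb/false]_l F l = false.
  by move=> F0; rewrite big1.
rewrite big_sumType /= (big_pred1 tt) ?addbF; last by case.
case: x y xNy => [x|] [y|] xNy //=.
- by rewrite f_odd.
- by rewrite bigN // => l; rewrite /conflict; case: (f x l).
- by rewrite bigN.
Qed.

(** * Sign words and the upper bounds *)

Definition sign_word (t : nat) (s : nat -> nat -> bool)
    (x : 'I_t * bool) (l : 'I_t) : option bool :=
  if x.1 == l then None else Some (s x.1 l (+) x.2).

Lemma odd_pred_ord t (i : 'I_t) : odd t.-1 = ~~ odd t.
Proof. by case: t i => [[]|t] //= _; rewrite negbK. Qed.

Lemma sum_ord_true t : \big[addb/false]_(l < t) true = odd t.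
Proof. by rewrite big_const_ord; elim: t => //= t ->. Qed.

(** For [i != j], the sum of [s i l (+) s j l (+) (e (+) d)] over all columns gives the row sums;
    removing the joker columns [i] and [j] leaves four entries of [s], since [e (+) d] occurs twice
    there. *)
Lemma sign_word_conflict t s (i j : 'I_t) e d :
  \big[addb/false]_l conflict (sign_word s (i, e) l) (sign_word s (j, d) l) =
  if i == j then odd t.-1 && (e (+) d) else
  (\big[addb/false]_(l < t) s i l) (+) (\big[addb/false]_(l < t) s j l)
  (+) (odd t && (e (+) d)) (+) s i i (+) s j i (+) s i j (+) s j j.
Proof.
have conflictE l : conflict (sign_word s (i, e) l) (sign_word s (j, d) l) =
   if (l != i) && (l != j) then s i l (+) s j l (+) (e (+) d) else false.
  rewrite /sign_word /= ![l == _]eq_sym.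
  by case: eqP; case: eqP => //= _ _; rewrite addbACA.
rewrite (eq_bigr _ (fun l _ => conflictE l)) -big_mkcond /=.
have sum_t : \big[addb/false]_(l < t) (e (+) d) = odd t && (e (+) d).
  rewrite -sum_ord_true; case: (e (+) d); first by rewrite andbT.
  by rewrite andbF big1.
case: eqP => [<-|/eqP iNj].
  rewrite (odd_pred_ord i); move: sum_t; rewrite (bigD1 i) //= => sum_i.
  rewrite (eq_bigr (fun=> e (+) d)) => [|l _]; last by rewrite addbb.
  rewrite (eq_bigl (fun l => l != i)) => [|l]; last by rewrite andbb.
  rewrite -[LHS](addKb (e (+) d)) sum_i.
  by case: (odd t); case: (e (+) d).
have := sum_t; pose g l := s i l (+) s j l (+) (e (+) d).
have : \big[addb/false]_(l < t) g l =
  (\big[addb/false]_(l < t) s i l) (+) (\big[addb/false]_(l < t) s j l)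
  (+) (odd t && (e (+) d)) by rewrite big_split /= sum_t big_split.
move=> <- _; rewrite [in RHS](bigD1 i) //= [in RHS](bigD1 j) 1?eq_sym //= /g.
move: (\big[addb/false]_(l < t | _) _) => P.
by case: P (e (+) d) (s i i) (s i j) (s j i) (s j j) => [] [] [] [] [] [].
Qed.

Lemma sum_ord_gt t (i : 'I_t) :
  \big[addb/false]_(l < t) (i < l) = ~~ (odd t (+) odd i).
Proof.
(* The factor [i < t] makes the formula true for every natural [i], so that induction on [t]
   applies. *)
suff -> : \big[addb/false]_(l < t) (i < l) = (i < t) && ~~ (odd t (+) odd i).
  by rewrite ltn_ord.
move: (nat_of_ord i) => {}i; elim: t => [|t IH]; first by rewrite big_ord0.
rewrite big_ord_recr /= {}IH ltnS.
by case: ltngtP => // [_|->]; rewrite ?addNb ?addbb ?addbT ?negbK.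
Qed.

Lemma ltn_ord_neg t (i j : 'I_t) : i != j -> (i < j) = ~~ (j < i).
Proof. by move=> iNj; rewrite -leqNgt ltn_neqAle iNj. Qed.

(** For [i != j], the last column cancels [odd i (+) odd j] from the row sums and
    [odd t && (e (+) d)]; the tournament leaves 1. For [i = j], it supplies the conflict exactly
    when [t] is odd. *)
Lemma odd_code_double_succ t :
  odd_code (fun (x : 'I_t * bool) (l : 'I_t + unit) =>
    if l is inl l then sign_word (fun i j => i < j) x l
    else Some (odd x.1 (+) (odd t && x.2))).
Proof.
case=> [i e] [j d]; rewrite xpair_eqE => xNy.
rewrite big_sumType /= (big_pred1 tt) /=; last by case.
rewrite sign_word_conflict; case: eqP xNy => [<-|/eqP iNj] /= xNy.
  rewrite (odd_pred_ord i).
  by move: xNy; case: (odd t) (odd i) e d => [] [] [] [].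
rewrite !sum_ord_gt !ltnn (ltn_ord_neg iNj).
by case: (odd t) (odd i) (odd j) (j < i) e d => [] [] [] [] [] [].
Qed.

(** The flips put [odd i] on the diagonal, which cancels the row sums; being symmetric, they keep
    [s i j (+) s j i = 1]. Row sums keep their parity, as there are [2 * k] odd indices. *)
Lemma odd_code_double k :
  odd_code (sign_word (t := 4 * k) (fun i j => (i < j) (+) (odd i && odd j))).
Proof.
have t_even : odd (4 * k) = false by rewrite oddM.
have odd_sum : \big[addb/false]_(l < 4 * k) odd l = false.
  elim: k {t_even} => [|k IH]; first by rewrite muln0 big_ord0.
  by rewrite mulnS addnC !addnS addn0 !big_ord_recr /= IH oddM.
have row_sum (i : 'I_(4 * k)) :
    \big[addb/false]_(l < 4 * k) ((i < l) (+) (odd i && odd l)) = ~~ odd i.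
  rewrite big_split /= sum_ord_gt t_even.
  by case: (odd i); rewrite /= ?odd_sum ?big1.
case=> [i e] [j d]; rewrite xpair_eqE => xNy.
rewrite sign_word_conflict; case: eqP xNy => [_|/eqP iNj] /= xNy.
  by rewrite (odd_pred_ord i) t_even; case: e d xNy => [] [].
rewrite !row_sum !ltnn t_even (ltn_ord_neg iNj) /=.
by case: (odd i) (odd j) (j < i) => [] [] [].
Qed.

Lemma b2_complete_upper n : b2 (complete_graph n) <= uphalf n + 1.
Proof.
have := @b2_complete_le n _ _ _ _ _ (@odd_code_double_succ (uphalf n)).
rewrite card_prod card_sum card_unit card_bool !card_ord; apply.
  by rewrite muln2 -leq_uphalf_double.
by rewrite addn1.
Qed.

Lemma b2_complete_upper_8k n k :
  0 < k -> n <= 8 * k -> b2 (complete_graph n) <= 4 * k.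
Proof.
move=> k_gt0 n_le; have := @b2_complete_le n _ _ _ _ _ (@odd_code_double k).
rewrite card_prod card_bool !card_ord; apply; last by rewrite muln_gt0.
by rewrite mulnAC.
Qed.

Lemma b2_complete_upper_8k1 k : b2 (complete_graph (8 * k + 1)) <= 4 * k + 1.
Proof.
have := @b2_complete_le (8 * k + 1) _ _ _ _ _
  (odd_code_star (@odd_code_double k)).
rewrite card_option card_prod card_sum card_unit card_bool !card_ord; apply.
  by rewrite mulnAC addn1.
by rewrite addn1.
Qed.

(** * Lower bound by ranks over F_2 *)

Local Open Scope ring_scope.

(* The field F_2 is [bool], with [addb] and [andb] as operations. *)
Lemma addrr_bool (a : bool) : a + a = 0.
Proof. exact: addbb. Qed.

Lemma addrr_mx_bool m n (A : 'M[bool]_(m, n)) : A + A = 0.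
Proof. by apply/matrixP => i j; rewrite !mxE addrr_bool. Qed.

Lemma symplectic_sum_lower m n (X Y : 'M[bool]_(m, n)) :
  (0 < m)%N -> (forall l i, X l i * Y l i = 0) ->
  X^T *m Y + Y^T *m X = const_mx 1 + 1%:M -> (n <= m.*2)%N.
Proof.
move=> m_gt0 XY0 XYE; rewrite -addnn leqNgt; apply/negP => n_gt.
pose N := col_mx X Y; pose U := col_mx Y X.
pose J : 'M[bool]_n := const_mx 1; pose A := J + 1%:M.
have NU : N^T *m U = A by rewrite tr_col_mx mul_row_col XYE.
have JJ : J *m J = (odd n : bool) *: J.
  apply/matrixP => i j; rewrite !mxE.
  under eq_bigr => l _ do rewrite !mxE mulr1.
  by rewrite mulr1 [LHS]sum_ord_true.
have AA : A *m A = (odd n : bool) *: J + 1%:M.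
  by rewrite mulmxDl !mulmxDr !mulmx1 mul1mx JJ addrA -(addrA _ J J)
    addrr_mx_bool addr0.
have AN : (\rank A <= \rank N)%N.
  by rewrite -NU (leq_trans (mxrankM_maxl _ _)) ?mxrank_tr.
have rankN : (\rank N <= m + m)%N by exact: rank_leq_row.
case n_odd : (odd n) AA => AA; last first.
  have : (n <= \rank A)%N.
    by rewrite -[leqLHS](mxrank1 bool) -[1%:M]add0r -(scale0r J) -AA mxrankM_maxl.
  by apply/negP; rewrite -ltnNge (leq_ltn_trans (leq_trans AN rankN)).
rewrite scale1r -/A in AA.
have rankJ : (\rank J <= 1)%N.
  have -> : J = (const_mx 1 : 'cV_n) *m (const_mx 1 : 'rV_n).
    by apply/matrixP => i j; rewrite !mxE big_ord1 !mxE mulr1.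
  exact: mulmx_max_rank.
have rankA : (m + m <= \rank A)%N.
  have : (n <= \rank J + \rank A)%N.
    rewrite -[leqLHS](mxrank1 bool) (leq_trans _ (mxrank_add J A)) //.
    by rewrite addrA addrr_mx_bool add0r.
  move/(leq_trans n_gt)/leq_trans/(_ (leq_add rankJ (leqnn _))).
  by rewrite add1n ltnS.
have NT_full : row_full N^T.
  by rewrite /row_full mxrank_tr eqn_leq rank_leq_row (leq_trans rankA).
have U_free : row_free U.
  rewrite /row_free eqn_leq rank_leq_row (leq_trans rankA) //.
  by rewrite -NU mxrankM_maxr.
have UN1 : U *m N^T = 1%:M.
  apply: (row_free_inj U_free); apply: (row_full_inj NT_full).
  by rewrite mul1mx -mulmxA mulmxA NU AA.
have YX1 : Y *m X^T = 1%:M.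
  have := congr1 (@ulsubmx _ m m m m) UN1.
  by rewrite tr_col_mx mul_col_row block_mxKul scalar_mx_block block_mxKul.
(* A diagonal entry exists because [0 < m]; for [m = 0], [n = 1] the bound would fail. *)
have := congr1 (fun M : 'M_m => M (Ordinal m_gt0) (Ordinal m_gt0)) YX1.
rewrite /= !mxE eqxx big1 // => i _.
by rewrite !mxE mulrC XY0.
Qed.

Lemma b2_complete_lower n : (uphalf n <= b2 (complete_graph n))%N.
Proof.
rewrite /b2; case: ex_minnP => m /existsP[s /andP[s_gt0 s_cover]] _.
rewrite size_tuple in s_gt0.
pose X : 'M[bool]_(m, n) := \matrix_(l, i) (i \in (val (tnth s l)).1).
pose Y : 'M[bool]_(m, n) := \matrix_(l, i) (i \in (val (tnth s l)).2).
have XY0 l i : X l i * Y l i = 0.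
  rewrite !mxE; have := valP (tnth s l); rewrite -setI_eq0 => /eqP/setP/(_ i).
  by rewrite !inE.
rewrite leq_uphalf_double; apply: (symplectic_sum_lower s_gt0 XY0).
apply/matrixP => i j; rewrite !mxE -big_split /=.
case: eqP => [<-|/eqP iNj].
  rewrite big1 // => l _; rewrite !mxE; have := XY0 l i; rewrite !mxE.
  by do 2!case: (_ \in _).
have /forallP/(_ i)/forallP/(_ j)/implyP/(_ iNj)/eqP := s_cover.
rewrite [adj _ _]iNj odd_count big_tuple addr0 => E.
rewrite -[RHS]E; apply: eq_bigr => l _.
rewrite !mxE /covers.
(* Disjoint parts exclude both disjuncts of [covers] holding at once, so the disjunction is a sum
   mod 2. *)
have := XY0 l i; rewrite !mxE.
by do 4!case: (_ \in _).
Qed.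

Local Close Scope ring_scope.

Theorem theorem6p4 :
  (forall n : nat, 0 < n ->
     uphalf n <= b2 (complete_graph n) <= uphalf n + 1) /\
  (forall k : nat, 0 < k ->
     [/\ b2 (complete_graph (8 * k - 1)) = 4 * k,
         b2 (complete_graph (8 * k)) = 4 * k &
         b2 (complete_graph (8 * k + 1)) = 4 * k + 1]).
Proof.
split=> [n _|k k_gt0]; first by rewrite b2_complete_lower b2_complete_upper.
have double4 : (4 * k).*2 = 8 * k by rewrite -muln2 mulnAC.
split; apply/eqP; rewrite eqn_leq.
- rewrite b2_complete_upper_8k ?leq_subr //=.
  apply: leq_trans (b2_complete_lower _).
  by rewrite geq_uphalf_double double4 subn1 prednK // muln_gt0.
- rewrite b2_complete_upper_8k //=.
  apply: leq_trans (b2_complete_lower _).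
  by rewrite geq_uphalf_double double4.
- rewrite b2_complete_upper_8k1 /=.
  apply: leq_trans (b2_complete_lower _).
  by rewrite geq_uphalf_double doubleD double4 addn2 addn1.
Qed.
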